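(* There exist a finite simple acyclic directed graph $G=(V,E)$ and vertices $u,v\in V$ such that, in $\tfrac12$-Bernoulli bond percolation on the bunkbed graph $\overline{G}$ of $G$, $$\mathbb{P}_{1/2}(u^-\to v^-)<\mathbb{P}_{1/2}(u^-\to v^+).$$
   Context: A directed graph is simple if it has no loops and no multiple edges, and acyclic if it contains no directed cycle. Bunkbed graph: for a directed graph $G=(V,E)$, let $(V^-,E^-)$ and $(V^+,E^+)$ be two disjoint copies of $G$, where $v^-$ and $v^+$ denote the copies of $v\in V$ in $V^-$ and $V^+$. The bunkbed graph $\overline{G}=(\overline{V},\overline{E})$ has $\overline{V}=V^-\sqcup V^+$ and $\overline{E}=E^-\sqcup E^+\sqcup\widetilde{E}$, where $\widetilde{E}$ consists of one bidirected (vertical) edge $(v^-,v^+)$ for each $v\in V$. Each horizontal edge (an element of $E^-\sqcup E^+$) keeps the direction it has in $G$; each vertical edge is a single edge that can be traversed in both directions. Percolation: $\mathbb{P}_{p}$ is the law of the random spanning subgraph of $\overline{G}$ in which every edge of $\overline{E}$ is retained with probability $p$ and deleted with probability $1-p$, independently of all other edges (each bidirected vertical edge is retained or deleted as one edge). For $x,y\in\overline{V}$, the event $x\to y$ is that the percolated subgraph contains a directed path from $x$ to $y$, where retained vertical edges may be used in either direction. *)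

(* Defs.v *)
From mathcomp Require Import all_boot all_order all_algebra.

Set Implicit Arguments.
Unset Strict Implicit.
Unset Printing Implicit Defensive.

Import GRing.Theory Num.Theory.
Local Open Scope ring_scope.

(* A finite directed graph is a finType V with an arc relation E : rel V, so  *)
(* there are no multiple arcs by construction; opposite arcs E x y and E y x  *)
(* are different arcs.                                                        *)

Definition simple_digraph (V : finType) (E : rel V) : Prop := irreflexive E.

(* [cycle E [::]] holds trivially, hence the nonemptiness condition.          *)
Definition acyclic (V : finType) (E : rel V) : Prop :=
  forall c : seq V, c != [::] -> ~~ ucycleb E c.

Section Bunkbed.
Variables (V : finType) (E : rel V).

Definition arc := {a : V * V | E a.1 a.2}.

Definition bvertex := (V + V)%type.
Definition minus (v : V) : bvertex := inl v.
Definition plus (v : V) : bvertex := inr v.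

Definition bedge := (arc + arc + V)%type.
Definition Eminus (a : arc) : bedge := inl (inl a).
Definition Eplus (a : arc) : bedge := inl (inr a).
Definition Evert (v : V) : bedge := inr v.

(* [traverses f x y]: f can be used to go from x to y.                        *)
Definition traverses (f : bedge) (x y : bvertex) : bool :=
  match f with
  | inl (inl a) => (x == minus (val a).1) && (y == minus (val a).2)
  | inl (inr a) => (x == plus (val a).1) && (y == plus (val a).2)
  | inr v => (x == minus v) && (y == plus v) || (x == plus v) && (y == minus v)
  end.

(* A percolation configuration is the set of retained edges.                  *)
Definition step (w : {set bedge}) : rel bvertex :=
  fun x y => [exists f in w, traverses f x y].

Definition reaches (x y : bvertex) : pred {set bedge} :=
  fun w => connect (step w) x y.

Definition bernoulli_weight (R : realFieldType) (p : R) (w : {set bedge}) : R :=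
  \prod_(f : bedge) (if f \in w then p else 1 - p).

Definition percolation_prob (R : realFieldType) (p : R)
    (A : pred {set bedge}) : R :=
  \sum_(w : {set bedge} | A w) bernoulli_weight p w.

End Bunkbed.

(* Main.v *)
(* The counterexample is built around the digraph with arcs                   *)
(*   u -> a -> x, u -> y, x -> y -> b -> z, x -> t, z -> t -> c -> v, z -> v. *)
(* Suppose first that the vertical edges at a, b, c are always retained. The  *)
(* vertex a puts x in either layer with equal probability. If the vertical    *)
(* edge at u, x, y, z, t or v is retained, then v^- and v^+ are equally       *)
(* likely to be reached; assume that none is. The layer of v matters only if  *)
(* c is not reached, and then v is reached through z. Now y is a bottleneck:  *)
(* b is less likely to be reached when x is in the layer of u than when x is  *)
(* in the other layer, because two layers give two chances for y -> b. For    *)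
(* the same reason c is more likely to be missed when z is in the layer of x. *)
(* Hence, on the event that c is missed, x and z tend to share a layer, and   *)
(* b is reached more often when this layer is the upper one.                  *)
(* To make the layers agree at a, b, c up to a small error, these vertices    *)
(* are preceded by chains of fans, a fan being three parallel paths of length *)
(* two. The resulting graph has 51 vertices and 201 bunkbed edges; since it   *)
(* is acyclic, its edges can be examined one at a time in topological order,  *)
(* and the two probabilities are computed exactly by dynamic programming over *)
(* the set of reached vertices that still matter.                             *)
From Stdlib Require Import NArith.
Require Import Defs.
From mathcomp Require Import all_boot all_order all_algebra.
From mathcomp Require Import zify ring.

Set Implicit Arguments.
Unset Strict Implicit.
Unset Printing Implicit Defensive.

Import Order.TTheory GRing.Theory Num.Theory.
Local Open Scope ring_scope.

(** In a topological order of the edges, a single scan decides reachability ([has_scan]).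
    Conditioning on the edges in that order gives a recursion for the probability
    ([percolation_prob_hit]), whose value is an integer count over a power of 2 common to both
    targets ([total_count_run]). The two counts are compared by computation ([counts_lt]). *)

Section Conditioning.
Variables (T : finType) (R : realFieldType) (p : R).

Definition expectation (G : {set T} -> R) : R :=
  \sum_(w : {set T}) \prod_(f : T) (if f \in w then p else 1 - p) * G w.

Lemma expectation_cst (c : R) : expectation (fun=> c) = c.
Proof.
rewrite /expectation -big_distrl /= -bigA_distr big1 ?mul1r // => f _.
exact: etrans (addrC _ _) (subrK _ _).
Qed.

Lemma expectation_edge (f : T) (G : {set T} -> R) :
  expectation G = p * expectation (fun w => G (f |: w)) +
                  (1 - p) * expectation (fun w => G (w :\ f)).
Proof.
(* [S] sums over the configurations without [f]; adding [f] to these yields all the others. *)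
pose W (w : {set T}) := \prod_(g | g != f) (if g \in w then p else 1 - p).
pose S (H : {set T} -> R) := \sum_(w : {set T} | f \notin w) W w * H w.
have split_f H :
    expectation H = p * S (fun w => H (f |: w)) + (1 - p) * S H.
  rewrite /expectation (bigID (fun w : {set T} => f \in w)) /=; congr (_ + _).
    rewrite (reindex_onto (fun w => f |: w) (fun w => w :\ f)) /=; last first.
      by move=> w fw; rewrite setD1K.
    rewrite mulr_sumr; apply: eq_big => [w|w].
      rewrite setU11 /=; apply/eqP/idP => [<-|fw]; first by rewrite setD11.
      by rewrite setU1K.
    case/andP=> _ /eqP w_f; rewrite (bigD1 f) //= setU11 -!mulrA.
    congr (_ * (_ * _)); apply: eq_bigr => g /negPf gf.
    by rewrite in_setU1 gf.
  rewrite mulr_sumr; apply: eq_bigr => w /negPf fw.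
  by rewrite (bigD1 f) //= fw mulrA.
rewrite (split_f (fun w => G (f |: w))) (split_f (fun w => G (w :\ f))).
have -> : S (fun w => G (f |: (f |: w))) = S (fun w => G (f |: w)).
  by apply: eq_bigr => w _; rewrite setUA setUid.
have -> : S (fun w => G (w :\ f)) = S G.
  apply: eq_bigr => w fw; congr (_ * G _); apply/setP => g; rewrite !inE.
  by case: eqVneq => // ->; rewrite (negPf fw).
have -> : S (fun w => G ((f |: w) :\ f)) = S G.
  by apply: eq_bigr => w fw; rewrite setU1K.
rewrite split_f; ring.
Qed.

End Conditioning.

(* A set of vertices of the bunkbed graph on 'I_n is a bit mask: the bit      *)
(* [2i] stands for [i^-] and [2i+1] for [i^+].                                *)
Definition has_bit (s : N) (b : nat) : bool := N.testbit s (N.of_nat b).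
Definition add_bit (s : N) (b : nat) : N := N.setbit s (N.of_nat b).
Definition drop_bit (s : N) (b : nat) : N := N.clearbit s (N.of_nat b).
Arguments has_bit : simpl never.
Arguments add_bit : simpl never.
Arguments drop_bit : simpl never.

Lemma eqb_of_nat (a b : nat) : N.eqb (N.of_nat a) (N.of_nat b) = (a == b).
Proof.
apply/idP/eqP => [/N.eqb_eq/Nnat.Nat2N.inj //|->]; exact: N.eqb_refl.
Qed.

Lemma has_add_bit s a b : has_bit (add_bit s a) b = (b == a) || has_bit s b.
Proof. by rewrite /has_bit /add_bit N.setbit_eqb eqb_of_nat eq_sym. Qed.

Lemma has_drop_bit s a b :
  has_bit (drop_bit s a) b = (b != a) && has_bit s b.
Proof.
by rewrite /has_bit /drop_bit N.clearbit_eqb eqb_of_nat eq_sym andbC.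
Qed.

Lemma mask_ext (s t : N) : has_bit s =1 has_bit t -> s = t.
Proof.
move=> st; apply: N.bits_inj => b.
by have := st (N.to_nat b); rewrite /has_bit Nnat.N2Nat.id.
Qed.

(* An edge of the bunkbed graph is the pair of the bits of its endpoints; it  *)
(* is vertical, hence bidirected, when these bits belong to the same vertex.  *)
Definition pass (m : nat * nat) (s : N) : N :=
  let s' := if has_bit s m.1 then add_bit s m.2 else s in
  if (m.1./2 == m.2./2) && has_bit s m.2 then add_bit s' m.1 else s'.

Lemma has_bit_pass m s b :
  has_bit (pass m s) b = [|| has_bit s b, (b == m.2) && has_bit s m.1 |
                           [&& b == m.1, m.1./2 == m.2./2 & has_bit s m.2]].
Proof.
rewrite /pass; case: (has_bit s m.1); case: (m.1./2 == m.2./2);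
  case: (has_bit s m.2); rewrite /= ?has_add_bit;
  by case: (b == m.1); case: (b == m.2); case: (has_bit s b).
Qed.

Lemma pass_drop_bit m s b :
  b != m.1 -> b != m.2 -> pass m (drop_bit s b) = drop_bit (pass m s) b.
Proof.
move=> b1 b2; apply: mask_ext => c.
rewrite has_bit_pass !has_drop_bit has_bit_pass [m.1 == b]eq_sym.
rewrite [m.2 == b]eq_sym b1 b2 /=.
case: (eqVneq c b) => [->|//] /=.
by rewrite (negPf b1) (negPf b2).
Qed.

(** * Reachability by one scan of the edges *)

Section Exploration.
Variables (n : nat) (E : rel 'I_n).

Definition bit (x : bvertex 'I_n) : nat :=
  match x with inl v => v.*2 | inr v => v.*2.+1 end.

Definition ends (f : bedge E) : nat * nat :=
  match f with
  | inl (inl a) => ((val a).1.*2, (val a).2.*2)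
  | inl (inr a) => ((val a).1.*2.+1, (val a).2.*2.+1)
  | inr v => (v.*2, v.*2.+1)
  end.

Definition scan (w : {set bedge E}) (s : N) (fs : seq (bedge E)) : N :=
  foldl (fun s f => if f \in w then pass (ends f) s else s) s fs.

Lemma bit_inj : injective bit.
Proof.
move=> [x|x] [y|y] /= xy; [congr inl | | | congr inr]; try apply: val_inj => /=;
  lia.
Qed.

Lemma ends_inj : injective ends.
Proof.
have ord_eq (x y : 'I_n) : x = y :> nat -> x = y by apply: val_inj.
move=> [[[[a b] ab]|[[a b] ab]]|x] [[[[c d] cd]|[[c d] cd]]|y] /= [h1 h2];
  try lia.
- have ac : a = c by apply: ord_eq; lia.
  have bd : b = d by apply: ord_eq; lia.
  by subst; congr (inl (inl _)); apply: val_inj.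
- have ac : a = c by apply: ord_eq; lia.
  have bd : b = d by apply: ord_eq; lia.
  by subst; congr (inl (inr _)); apply: val_inj.
- by congr inr; apply: ord_eq; lia.
Qed.

Lemma traverses_half (f : bedge E) x y : traverses f x y ->
  (bit x)./2 = (ends f).1./2 /\ (bit y)./2 = (ends f).2./2.
Proof.
by case: f => [[a|a]|v] /=; [| | case/orP]; case/andP=> /eqP-> /eqP-> /=; split;
  lia.
Qed.

Lemma has_bit_pass_ends f s y :
  has_bit (pass (ends f) s) (bit y) <->
  has_bit s (bit y) \/ exists2 x, has_bit s (bit x) & traverses f x y.
Proof.
split=> [|[h|[x hx]]]; last 2 first.
- by rewrite has_bit_pass h.
- case: f => [[a|a]|v] /=; [| | case/orP]; case/andP=> /eqP xE /eqP ->;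
    rewrite has_bit_pass /=; rewrite xE /= in hx; rewrite ?hx ?eqxx ?orbT //.
  by rewrite doubleK uphalf_double eqxx !orbT.
rewrite has_bit_pass => /or3P[->|/andP[/eqP yE h]|/and3P[/eqP yE ab h]].
- by left.
- right; case: f yE h => [[a|a]|v] /= yE h.
  + exists (minus (val a).1) => //; rewrite eqxx /=; apply/eqP.
    exact: bit_inj.
  + exists (plus (val a).1) => //; rewrite eqxx /=; apply/eqP.
    exact: bit_inj.
  + exists (minus v) => //; rewrite eqxx /=; apply/orP; left; apply/eqP.
    exact: bit_inj.
- case: f yE ab h => [[a|a]|v] /= yE ab h.
  + by left; rewrite yE; move: ab h; rewrite !doubleK => /eqP->.
  + by left; rewrite yE; move: ab h; rewrite !uphalf_double => /eqP->.
  + right; exists (plus v) => //; rewrite [plus v == plus v]eqxx andTb.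
    by apply/orP; right; apply/eqP/bit_inj.
Qed.

(** Taken pairwise, this is topological order: once an edge leaving a vertex is listed, the set of
    reached copies of that vertex is final. *)
Definition before (m m' : nat * nat) : bool := m'.2./2 != m.1./2.

Lemma scan_mono w s fs b : has_bit s b -> has_bit (scan w s fs) b.
Proof.
elim: fs s => //= f fs IH s sb; apply: IH.
by case: ifP => // _; rewrite has_bit_pass sb.
Qed.

Lemma scan_keep w s fs b : all (fun g => (ends g).2./2 != b./2) fs ->
  has_bit (scan w s fs) b -> has_bit s b.
Proof.
elim: fs s => //= f fs IH s /andP[fb /IH{}IH] /IH.
case: ifP => // _; rewrite has_bit_pass => /or3P[//|/andP[/eqP bE _]|].
  by rewrite bE eqxx in fb.
by case/and3P=> /eqP bE /eqP ff; rewrite bE ff eqxx in fb.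
Qed.

Lemma traverses_back (f : bedge E) z x y :
  traverses f z x -> traverses f x y -> y = x \/ y = z.
Proof.
case: f => [[a|a]|v] /=; [| | case/orP => /andP[/eqP-> /eqP->]].
- by case/andP=> _ /eqP-> /andP[_ /eqP->]; left.
- by case/andP=> _ /eqP-> /andP[_ /eqP->]; left.
- by case/orP=> /andP[/eqP // _ /eqP->]; right.
- by case/orP=> /andP[/eqP // _ /eqP->]; right.
Qed.

(** No edge after [f] can reach [x], so [x] is reached before [f] or through [f] itself; in the
    latter case [f] only leads back to a vertex already reached. *)
Lemma scan_closed (w : {set bedge E}) s fs (f : bedge E) x y :
  pairwise (relpre ends before) fs -> f \in fs -> f \in w ->
  traverses f x y ->
  has_bit (scan w s fs) (bit x) -> has_bit (scan w s fs) (bit y).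
Proof.
move=> + + fw fxy; elim: fs s => //= g fs IH s /andP[gfs pfs].
rewrite inE; case: eqVneq => [fg _|_ /= ffs]; last exact: IH.
rewrite -fg in gfs *; rewrite fw => sx; apply: scan_mono.
have [xE _] := traverses_half fxy.
have {}sx : has_bit (pass (ends f) s) (bit x).
  by apply: scan_keep sx; rewrite xE; apply: sub_all gfs.
have /has_bit_pass_ends[sx'|[z sz fzx]] := sx.
  by apply/has_bit_pass_ends; right; exists x.
case: (traverses_back fzx fxy) => -> //.
by rewrite has_bit_pass sz.
Qed.

Lemma has_scan (w : {set bedge E}) u (fs : seq (bedge E)) y :
  (forall f : bedge E, f \in fs) -> pairwise (relpre ends before) fs ->
  has_bit (scan w (add_bit 0 (bit u)) fs) (bit y) = connect (step w) u y.
Proof.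
move=> allfs pfs; apply/idP/connectP => [|[p]].
  suff: forall s, (forall x, has_bit s (bit x) -> connect (step w) u x) ->
      has_bit (scan w s fs) (bit y) -> connect (step w) u y.
    move=> sound sy; apply/connectP; apply: sound sy => x.
    rewrite has_add_bit [has_bit 0 _]N.bits_0 orbF => /eqP/bit_inj->.
    exact: connect0.
  elim: fs {allfs pfs} => /= [|f fs IH] s us; first exact: us.
  apply: IH => x; case: ifP => fw; last exact: us.
  case/has_bit_pass_ends=> [|[z sz fzx]]; first exact: us.
  apply: connect_trans (us z sz) (connect1 _).
  by apply/existsP; exists f; rewrite fw.
elim/last_ind: p y => [|p z IH] y /=.
  by move=> _ ->; apply: scan_mono; rewrite has_add_bit eqxx.
rewrite rcons_path last_rcons => /andP[/IH{}IH /existsP[f /andP[fw fz]]] ->.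
exact: scan_closed fw fz (IH _ erefl).
Qed.

End Exploration.

(** * Conditioning on successive edges *)

Section Recursion.
Variables (R : realFieldType) (t : nat).

Fixpoint hit_prob (ms : seq (nat * nat)) (s : N) : R :=
  if ms is m :: ms' then 2^-1 * hit_prob ms' (pass m s) + 2^-1 * hit_prob ms' s
  else (has_bit s t)%:R.

(** As [fs] has no repetition, fixing the state of its head does not affect the rest of the scan. *)
Lemma expectation_scan n (E : rel 'I_n) (fs : seq (bedge E)) s : uniq fs ->
  expectation 2^-1 (fun w => (has_bit (scan w s fs) t)%:R : R) =
  hit_prob (map (@ends n E) fs) s.
Proof.
elim: fs s => [|f fs IH] s /=; first by rewrite expectation_cst.
case/andP=> ffs ufs; rewrite (expectation_edge _ f) -!IH //.
have scan_eq (w w' : {set bedge E}) s' : {in fs, w =i w'} ->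
    scan w s' fs = scan w' s' fs.
  rewrite /scan; elim: fs s' {IH ffs ufs} => //= g fs IH s' ww'.
  rewrite ww' ?mem_head // IH // => h hfs.
  by apply: ww'; rewrite in_cons hfs orbT.
have fE g : g \in fs -> (g == f) = false.
  by move=> gfs; apply/eqP=> gf; rewrite -gf gfs in ffs.
have -> : 1 - 2^-1 = 2^-1 :> R by field.
congr (_ * _ + _ * _); apply: eq_bigr => w _; rewrite ?setU11 ?setD11;
  by rewrite (scan_eq _ w) // => g /fE gf; rewrite !inE gf.
Qed.

Lemma percolation_prob_hit n (E : rel 'I_n) (ms : seq (nat * nat)) u y :
  uniq ms -> pairwise before ms ->
  (forall m, m \in ms <-> exists f : bedge E, ends f = m) -> bit y = t ->
  percolation_prob (2^-1 : R) (@reaches 'I_n E u y) =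
  hit_prob ms (add_bit 0 (bit u)).
Proof.
move=> ums pms msE yt.
have [fs fsE] : exists fs : seq (bedge E), map (@ends n E) fs = ms.
  have: forall m, m \in ms -> exists f : bedge E, ends f = m.
    by move=> m /msE.
  elim: ms {ums pms msE} => [|m ms IH] msE; first by exists [::].
  have [|fs <-] := IH.
    by move=> m' m'ms; apply: msE; rewrite inE m'ms orbT.
  by have [|f <-] := msE m; [rewrite mem_head | exists (f :: fs)].
have ufs : uniq fs by apply: (@map_uniq _ _ (@ends n E)); rewrite fsE.
rewrite -fsE -expectation_scan // /percolation_prob big_mkcond /=.
apply: eq_bigr => w _; rewrite -yt has_scan.
- by rewrite /reaches /=; case: connect; rewrite ?mulr1 ?mulr0.
- move=> f; rewrite -(mem_map (@ends_inj n E)) fsE; apply/msE.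
  by exists f.
- by rewrite -pairwise_map fsE.
Qed.

Lemma hit_prob_drop_bit ms b s :
  all (fun m => (b != m.1) && (b != m.2)) ms -> b != t ->
  hit_prob ms (drop_bit s b) = hit_prob ms s.
Proof.
move=> + bt; elim: ms s => [|m ms IH] s /=.
  by rewrite has_drop_bit eq_sym bt.
by case/andP=> /andP[b1 b2] bms; rewrite pass_drop_bit // !IH.
Qed.

End Recursion.

(** * Dynamic programming with integer counts *)

Fixpoint add_count (s c : N) (d : seq (N * N)) : seq (N * N) :=
  if d is (s', c') :: d' then
    if N.eqb s s' then (s', N.add c c') :: d' else (s', c') :: add_count s c d'
  else [:: (s, c)].

(* An entry [(s, c)] of [d] means that [c] configurations of the edges        *)
(* examined so far lead to the set [s] of reached vertices. The bit [m.1] is  *)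
(* forgotten once neither a later edge nor the final test on the bits [ts]    *)
(* looks at it, which is what keeps [d] short.                                *)
Definition count_step (ts : seq nat) (m : nat * nat) (ms : seq (nat * nat))
    (d : seq (N * N)) : seq (N * N) :=
  let dead := all (fun m' => (m.1 != m'.1) && (m.1 != m'.2)) ms &&
              (m.1 \notin ts) in
  let clean s := if dead then drop_bit s m.1 else s in
  foldr (fun sc d' => add_count (clean (pass m sc.1)) sc.2
                        (add_count (clean sc.1) sc.2 d')) [::] d.

Fixpoint count_run (ts : seq nat) (ms : seq (nat * nat)) (d : seq (N * N)) :=
  if ms is m :: ms' then count_run ts ms' (count_step ts m ms' d) else d.

Definition count_hits (t : nat) (d : seq (N * N)) : N :=
  foldr (fun sc c => if has_bit sc.1 t then N.add sc.2 c else c) 0%num d.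

Section Counting.
Variables (R : realFieldType) (ts : seq nat) (t : nat).
Hypothesis t_ts : t \in ts.

Definition total (ms : seq (nat * nat)) (d : seq (N * N)) : R :=
  \sum_(sc <- d) (N.to_nat sc.2)%:R * hit_prob R t ms sc.1.

Lemma total_cons ms s c d :
  total ms ((s, c) :: d) = (N.to_nat c)%:R * hit_prob R t ms s + total ms d.
Proof. by rewrite /total big_cons. Qed.

Lemma total_add_count ms s c d :
  total ms (add_count s c d) =
  (N.to_nat c)%:R * hit_prob R t ms s + total ms d.
Proof.
elim: d => [|[s' c'] d IH] /=; first exact: total_cons.
case: (N.eqb_spec s s') => [->|_]; rewrite !total_cons ?IH.
  by rewrite Nnat.N2Nat.inj_add natrD mulrDl addrA.
by rewrite addrCA.
Qed.

Lemma total_count_step m ms d :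
  total ms (count_step ts m ms d) = 2 * total (m :: ms) d.
Proof.
rewrite /count_step; set dead := _ && _.
have clean s : hit_prob R t ms (if dead then drop_bit s m.1 else s) =
    hit_prob R t ms s.
  rewrite /dead; case: ifP => // /andP[mms mts]; apply: hit_prob_drop_bit => //.
  by apply: contraNneq mts => ->.
elim: d => [|[s c] d IH] /=; first by rewrite /total !big_nil mulr0.
by rewrite !total_add_count !clean IH total_cons /=; field.
Qed.

Lemma total_count_run ms d :
  total ms d =
  2^-1 ^+ size ms * (N.to_nat (count_hits t (count_run ts ms d)))%:R.
Proof.
elim: ms d => [|m ms IH] d /=.
  rewrite expr0 mul1r; elim: d => [|[s c] d IH] /=.
    by rewrite /total big_nil.
  rewrite total_cons IH /=; case: has_bit; rewrite ?mulr0 ?add0r // mulr1.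
  by rewrite Nnat.N2Nat.inj_add natrD.
by rewrite exprS -mulrA -IH total_count_step mulrA mulVf ?mul1r // pnatr_eq0.
Qed.

End Counting.

(** * The explicit graph *)

Definition fan (x : nat) : seq (nat * nat) :=
  [:: (x, x); (x, x + 1); (x + 1, x + 1); (x + 1, x + 4);
      (x, x + 2); (x + 2, x + 2); (x + 2, x + 4);
      (x, x + 3); (x + 3, x + 3); (x + 3, x + 4)]%N.

(* The pair [(x, x)] stands for the vertical edge at [x]; it is listed after  *)
(* all the arcs into [x] and before all the arcs out of [x]. In the notation  *)
(* of the header, a = 12, x = 13, y = 14, b = 35, z = 36, t = 37 and the last *)
(* chain of fans leads from 38 directly to v = 50.                            *)
Definition edges : seq (nat * nat) :=
  fan 0 ++ fan 4 ++ fan 8 ++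
  [:: (12, 12); (12, 13); (13, 13); (0, 14); (13, 14); (14, 14); (14, 15)] ++
  fan 15 ++ fan 19 ++ fan 23 ++ fan 27 ++ fan 31 ++
  [:: (35, 35); (35, 36); (36, 36); (13, 37); (36, 37); (37, 37); (37, 38)] ++
  fan 38 ++ fan 42 ++ fan 46 ++ [:: (36, 50); (50, 50)].

Definition bedges : seq (nat * nat) :=
  flatten [seq if e.1 == e.2 then [:: (e.1.*2, e.1.*2.+1)]
           else [:: (e.1.*2, e.2.*2); (e.1.*2.+1, e.2.*2.+1)] | e <- edges].

Definition G : rel 'I_51 := fun x y => (x != y) && ((val x, val y) \in edges).

Lemma edges_lt : all (fun e => (e.1 <= e.2 < 51)%N) edges.
Proof. by vm_compute. Qed.

Lemma edges_vertical (v : 'I_51) : (val v, val v) \in edges.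
Proof.
have : all (fun i => (i, i) \in edges) (iota 0 51) by vm_compute.
by move/allP; apply; rewrite mem_iota leq0n add0n ltn_ord.
Qed.

Lemma G_lt (x y : 'I_51) : G x y -> (x < y)%N.
Proof.
case/andP=> xy /(allP edges_lt)/= /andP[le_xy _].
by rewrite ltn_neqAle le_xy andbT.
Qed.

Lemma acyclic_lt n (E : rel 'I_n) :
  (forall x y, E x y -> (x < y)%N) -> acyclic E.
Proof.
move=> E_lt [//|x p] _; apply/negP => /andP[/= xp _].
have : path (relpre val ltn) x (rcons p x) by apply: sub_path xp.
rewrite -path_map.
move/(order_path_min ltn_trans)/allP/(_ (val x)).
by rewrite map_rcons mem_rcons mem_head ltnn => /(_ isT).
Qed.

Lemma mem_bedges m : m \in bedges <-> exists f : bedge G, ends f = m.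
Proof.
split=> [/flatten_mapP[[i j] ije]|[f <-]].
  have /andP[/= ij j_lt] := allP edges_lt _ ije.
  have i_lt := leq_ltn_trans ij j_lt.
  rewrite /=; case: eqP => [_|/eqP ij']; rewrite !inE.
    by move/eqP->; exists (inr (Ordinal i_lt)).
  have Gij : G (Ordinal i_lt) (Ordinal j_lt) by apply/andP.
  case/orP=> /eqP->.
    by exists (inl (inl (exist _ (Ordinal i_lt, Ordinal j_lt) Gij))).
  by exists (inl (inr (exist _ (Ordinal i_lt, Ordinal j_lt) Gij))).
case: f => [[[[x y] /= Gxy]|[[x y] /= Gxy]]|v] /=; apply/flatten_mapP.
- case/andP: (Gxy) => xy xye; exists (val x, val y) => //=.
  by rewrite (negPf xy : (val x == val y) = false) mem_head.
- case/andP: (Gxy) => xy xye; exists (val x, val y) => //=.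
  by rewrite (negPf xy : (val x == val y) = false) !inE eqxx orbT.
- by exists (val v, val v); [exact: edges_vertical | rewrite /= eqxx mem_head].
Qed.

Lemma uniq_bedges : uniq bedges.
Proof. by vm_compute. Qed.

Lemma bedges_ordered : pairwise before bedges.
Proof. by vm_compute. Qed.

(** Bit 0 is [u^-]; bits 100 and 101 are the two copies of v = 50. *)
Definition counts : seq (N * N) :=
  count_run [:: 100; 101]%N bedges [:: (add_bit 0 0, 1%num)].

Lemma counts_lt :
  (N.to_nat (count_hits 100 counts) < N.to_nat (count_hits 101 counts))%N.
Proof.
(* The counts are far too large for unary numbers, so they are compared in binary. *)
apply/ssrnat.ltP/PeanoNat.Nat.compare_lt_iff; rewrite -Nnat.N2Nat.inj_compare.
apply/N.ltb_lt.
have : (let d := counts in N.ltb (count_hits 100 d) (count_hits 101 d)) = true.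
  by vm_compute.
exact.
Qed.

Lemma percolation_prob_counts (R : realFieldType) y t :
  bit y = t -> t \in [:: 100; 101]%N ->
  percolation_prob (2^-1 : R) (@reaches 'I_51 G (minus ord0) y) =
  2^-1 ^+ size bedges * (N.to_nat (count_hits t counts))%:R.
Proof.
move=> yt tE; rewrite -total_count_run // /total big_seq1 mul1r.
exact: percolation_prob_hit uniq_bedges bedges_ordered mem_bedges yt.
Qed.

Theorem theorem1p2 (R : realFieldType) :
  exists (V : finType) (E : rel V) (u v : V),
    [/\ simple_digraph E, acyclic E &
        percolation_prob (2^-1 : R) (@reaches V E (minus u) (minus v)) <
        percolation_prob (2^-1 : R) (@reaches V E (minus u) (plus v))].
Proof.
exists 'I_51, G, ord0, ord_max; split.
- by move=> x; rewrite /G eqxx.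
- exact/acyclic_lt/G_lt.
rewrite (@percolation_prob_counts R _ 100) //.
rewrite (@percolation_prob_counts R _ 101) //.
rewrite ltr_pM2l; last by rewrite exprn_gt0 // invr_gt0 ltr0n.
rewrite ltr_nat; exact: counts_lt.
Qed.
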